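(* Let $k\ge 1$. Every $k$-constructible graph $G=(V,E)$ with $n\ge k+1$ vertices satisfies $|E|\le nk-\binom{k+1}{2}$.
   Context: A graph $G=(V,E)$ is called $k$-constructible if there is an ordering $e_1,\dots,e_m$ of $E$ such that for every $i\in\{1,\dots,m\}$ the graph $(V,\{e_1,\dots,e_{i-1}\})$ contains at most $k-1$ internally vertex-disjoint paths between the two endpoints of $e_i$. *)

(* Defs.v *)
From mathcomp Require Import all_boot.
Set Implicit Arguments. Unset Strict Implicit. Unset Printing Implicit Defensive.

Definition simple_edges (T : finType) (E : {set {set T}}) : Prop :=
  forall e, e \in E -> #|e| = 2.

Definition adj (T : finType) (F : {set {set T}}) : rel T :=
  fun x y => [set x; y] \in F.

Definition is_uv_path (T : finType) (F : {set {set T}}) (u v : T) (p : seq T) : bool :=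
  uniq (u :: rcons p v) && path (adj F) u (rcons p v).

Definition ivd_paths (T : finType) (F : {set {set T}}) (u v : T) (ps : seq (seq T)) : bool :=
  [&& uniq ps, all (is_uv_path F u v) ps &
      pairwise (fun p q => ~~ has (fun x => x \in q) p) ps].

Definition k_constructible (T : finType) (k : nat) (E : {set {set T}}) : Prop :=
  exists s : seq {set T},
    perm_eq s (enum E) /\
    forall (i : nat) (u v : T), i < size s -> nth set0 s i = [set u; v] -> u != v ->
      forall ps : seq (seq T),
        ivd_paths [set e | e \in take i s] u v ps -> size ps <= k.-1.

(* Main.v *)
(** Rigidity-type argument, with Kalai's hyperconnectivity matroid in place of
    generic rigidity.  Give the vertices distinct numbers [t w].  To a family
    [q] of polynomials of degree less than [k], one for each vertex, the edge
    [wz] assigns the value [q_w(t_z) - q_z(t_w)].  These linear functionals on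
    a space of dimension [n k] all vanish on the families [q_w = s(., t_w)]
    with [s] a symmetric bivariate polynomial, a subspace of dimension
    [binomial(k+1, 2)]; hence at most [n k - binomial(k+1, 2)] of them are
    linearly independent.  The edges of a constructible graph are independent:
    when [uv] is added, Menger's theorem gives a set [S] of fewer than [k]
    vertices separating [u] from [v]; with [a] the polynomial vanishing exactly
    at the numbers of [S], the family [q_w = a(t_w) a] for [w] on the side of
    [u], and [q_w = 0] elsewhere, is killed by all earlier edges but not by
    [uv]. *)
Require Import Defs.
From mathcomp Require Import all_boot all_algebra.
Set Implicit Arguments. Unset Strict Implicit. Unset Printing Implicit Defensive.
Import GRing.Theory.

(** * Menger's theorem between two vertex sets of a finite digraph *)

Section Menger.
Variable T : finType.
Implicit Types (E : {set T * T}) (A B S : {set T}).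

Definition arc E : rel T := fun x y => (x, y) \in E.

(** A walk may consist of one vertex, so [S] contains [A :&: B]. *)
Definition separates E A B S :=
  forall x p, x \in A -> last x p \in B -> path (arc E) x p -> has [in S] (x :: p).

Definition linked E A B n :=
  exists (a : 'I_n -> T) (p : 'I_n -> seq T),
    (forall i, [/\ a i \in A, last (a i) (p i) \in B,
                   path (arc E) (a i) (p i) & uniq (a i :: p i)]) /\
    (forall i j z, z \in a i :: p i -> z \in a j :: p j -> i = j).

(** Shortening a walk to a path only drops vertices, so disjointness survives. *)
Lemma linked_of_walks E A B n (a : 'I_n -> T) (p : 'I_n -> seq T) :
  (forall i, [/\ a i \in A, last (a i) (p i) \in B & path (arc E) (a i) (p i)]) ->
  (forall i j z, z \in a i :: p i -> z \in a j :: p j -> i = j) ->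
  linked E A B n.
Proof.
move=> walk_p disj; exists a, (fun i => shorten (a i) (p i)); split.
  move=> i; have [? lastB path_p] := walk_p i.
  by case: (shortenP path_p) lastB => p' path_p' uniq_p' _ lastB.
have sub i z : z \in a i :: shorten (a i) (p i) -> z \in a i :: p i.
  have [_ _ path_p] := walk_p i.
  case: (shortenP path_p) => p' _ _ sub_p; rewrite !inE => /predU1P[->|/sub_p ->].
    by rewrite eqxx.
  by rewrite orbT.
by move=> i j z /sub zi /sub zj; apply: disj zi zj.
Qed.

Lemma arcD1_path E x y a p :
  x \notin belast a p -> path (arc E) a p -> path (arc (E :\ (x, y))) a p.
Proof.
elim: p a => //= b p IHp a; rewrite inE negb_or => /andP[xa xp] /andP[ab pp].
by rewrite IHp // andbT /arc !inE xpair_eqE eq_sym (negbTE xa).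
Qed.

Lemma arcD1_path_target E x y a p :
  y \notin p -> path (arc E) a p -> path (arc (E :\ (x, y))) a p.
Proof.
elim: p a => //= b p IHp a; rewrite inE negb_or => /andP[yb yp] /andP[ab pp].
by rewrite IHp // andbT /arc !inE xpair_eqE [b == y]eq_sym (negbTE yb) andbF.
Qed.

Lemma arc_sub_path E E' a p :
  E' \subset E -> path (arc E') a p -> path (arc E) a p.
Proof. by move=> /subsetP sEE; apply: sub_path => x y; apply: sEE. Qed.

(** Cut the walk at its first vertex in [x |: S]: the initial part never leaves [x], so it avoids
    the arc and meets [S']. Such a vertex exists, since a walk missing [x] avoids the arc and meets
    [S]. *)
Lemma separates_left E A B S S' x y :
  separates (E :\ (x, y)) A B S -> separates (E :\ (x, y)) A (x |: S) S' ->
  separates E A B S'.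
Proof.
move=> sepS sepS' a p aA lastB path_p.
have [hitP|noP] := boolP (has [in x |: S] (a :: p)); last first.
  have xp : x \notin belast a p.
    apply: contra noP => /mem_belast xp; apply/hasP; exists x => //=.
    by rewrite setU11.
  have /hasP[z zp /= zS] := sepS _ _ aA lastB (arcD1_path y xp path_p).
  by case/hasP: noP; exists z; rewrite //= setU1r.
have [aP|aP] := boolP (a \in x |: S).
  by have /= := sepS' a [::] aA aP isT; rewrite orbF => ->.
move: hitP; rewrite [has _ _]/= (negbTE aP) /= => hitP.
case: (split_find hitP) path_p => z p1 p2 /= zP nP.
rewrite cat_path => /andP[path1 _].
have xp : x \notin belast a (rcons p1 z).
  rewrite belast_rcons inE negb_or; apply/andP; split.
    by apply: contraNneq aP => <-; rewrite setU11.
  by apply: contra nP => xp; apply/hasP; exists x; rewrite //= setU11.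
have := sepS' a (rcons p1 z) aA; rewrite last_rcons => /(_ zP (arcD1_path y xp path1)).
by rewrite has_cat /= => /orP[->|->]; rewrite ?orbT.
Qed.

(** Mirror image: the walk is cut at its last vertex in [y |: S], after which it never enters
    [y]. *)
Lemma separates_right E A B S S' x y :
  separates (E :\ (x, y)) A B S -> separates (E :\ (x, y)) (y |: S) B S' ->
  separates E A B S'.
Proof.
move=> sepS sepS' a p aA lastB path_p.
have [hasQ|noQ] := boolP (has [in y |: S] (a :: p)); last first.
  have yp : y \notin p.
    apply: contra noQ => yp; apply/hasP; exists y; first by rewrite inE yp orbT.
    by rewrite /= setU11.
  have /hasP[z zp /= zS] := sepS _ _ aA lastB (arcD1_path_target x yp path_p).
  by case/hasP: noQ; exists z; rewrite //= setU1r.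
elim: p a {aA} lastB path_p hasQ => [|c p IHp] a lastB path_p.
  by rewrite [has _ _]/= orbF => aQ; apply: (sepS' a [::]).
have [hasQ _|noQ] := boolP (has [in y |: S] (c :: p)).
  have /andP[_ path_c] := path_p.
  by rewrite [has _ _]/=; apply/orP; right; apply: IHp.
rewrite [has _ _]/= -/(has _ (c :: p)) (negbTE noQ) orbF => aQ.
have yp : y \notin c :: p.
  by apply: contra noQ => yp; apply/hasP; exists y; rewrite //= setU11.
exact: sepS' aQ lastB (arcD1_path_target x yp path_p).
Qed.

Lemma imset_inj_full n (f : 'I_n -> T) (Q : {set T}) :
  injective f -> (forall i, f i \in Q) -> #|Q| <= n -> f @: setT = Q.
Proof.
move=> f_inj fQ leQ; apply/eqP; rewrite eqEcard card_imset // cardsT card_ord leQ andbT.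
by apply/subsetP => _ /imsetP[i _ ->].
Qed.

(** As [#|S| < n], the [n] disjoint paths of each linkage use up all of [x |: S] as ends, or all of
    [y |: S] as starts. Each path into [S] thus has a continuation at the same vertex, and the one
    into [x] continues over the arc to [y]. *)
Lemma linked_cat E A B S x y n :
  (x, y) \in E -> #|S| < n -> separates (E :\ (x, y)) A B S ->
  linked (E :\ (x, y)) A (x |: S) n -> linked (E :\ (x, y)) (y |: S) B n ->
  linked E A B n.
Proof.
move=> xyE ltSn sepS [a [p [walk_p disj_p]]] [b [q [walk_q disj_q]]].
have cardQ z : #|z |: S| <= n.
  by rewrite cardsU1; apply: leq_trans ltSn; rewrite -add1n leq_add2r leq_b1.
have last_inj : injective (fun i => last (a i) (p i)).
  by move=> i j e; apply: (disj_p i j _ (mem_last _ _)); rewrite e mem_last.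
have b_inj : injective b.
  by move=> i j e; apply: (disj_q i j (b i)); rewrite ?e mem_head.
have lastP i : last (a i) (p i) \in x |: S by case: (walk_p i).
have bQ j : b j \in y |: S by case: (walk_q j).
have lastE := imset_inj_full last_inj lastP (cardQ x).
have bE := imset_inj_full b_inj bQ (cardQ y).
have startE s : s \in y |: S -> exists j, b j == s.
  by rewrite -bE => /imsetP[j _ ->]; exists j.
have yS : y \notin S.
  apply: contraL ltSn => yS; rewrite -leqNgt.
  by have := card_imset setT b_inj; rewrite bE cardsT card_ord cardsU1 yS add0n => ->.
have p_last i z : z \in a i :: p i -> z \in x |: S -> z = last (a i) (p i).
  by move=> zi; rewrite -lastE => /imsetP[i' _ ez]; rewrite (disj_p i i' z) // ez mem_last.
have q_head j z : z \in b j :: q j -> z \in y |: S -> z = b j.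
  by move=> zj; rewrite -bE => /imsetP[j' _ ez]; rewrite (disj_q j j' z) // ez mem_head.
(* Switching at [z] from one path to the other gives a walk from [A] to [B] without the arc, so it
   meets [S]. The first path can do so only at its end and the second only at its start, which
   forces the meeting point to be [z]. *)
have meet i j z : z \in a i :: p i -> z \in b j :: q j -> z \in S.
  move=> zi zj; have [aA _ path_p uniq_p] := walk_p i.
  have [_ lastB path_q uniq_q] := walk_q j.
  have p_lasti := p_last i; have q_headj := q_head j.
  case/splitPl: zi path_p uniq_p p_lasti => p1 p2 ez1.
  rewrite cat_path => /andP[path1 _] uniq_p p_lasti.
  case/splitPl: zj lastB path_q uniq_q q_headj => q1 q2 ez2.
  rewrite last_cat cat_path ez2 => lastB /andP[_ path2] uniq_q q_headj.
  have /hasP[w] : has [in S] (a i :: p1 ++ q2).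
    by apply: sepS; rewrite ?last_cat ?ez1 // cat_path path1 ez1.
  rewrite -cat_cons mem_cat => /orP[w1|w2] /= wS.
    have := p_lasti w; rewrite -cat_cons mem_cat w1 setU1r // => /(_ isT isT).
    case: p2 uniq_p {p_lasti} => [|c p2]; first by rewrite cats0 ez1 => _ <-.
    rewrite -cat_cons cat_uniq => /and3P[_ /hasPn nop _].
    by rewrite last_cat /= => ew; have := nop _ (mem_last c p2); rewrite /= -ew w1.
  have := q_headj w; rewrite inE mem_cat w2 !orbT setU1r // => /(_ isT isT) ew.
  by move: uniq_q; rewrite cons_uniq mem_cat -ew w2 orbT.
pose next i := if last (a i) (p i) == x then y else last (a i) (p i).
have nextQ i : next i \in y |: S.
  have := lastP i; rewrite /next; case: eqP => [_ _|/eqP ne]; first by rewrite setU11.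
  by rewrite !inE (negbTE ne) /= => ->; rewrite orbT.
have nextS i : next i \in S -> next i = last (a i) (p i).
  by rewrite /next; case: ifP => // _; rewrite (negbTE yS).
have next_inj : injective next.
  have aux i j : next i = next j -> last (a i) (p i) = x -> last (a j) (p j) = x.
    rewrite /next => + ei; rewrite ei eqxx; case: eqP => // ne ey.
    by have := lastP j; rewrite -ey !inE (negbTE yS) orbF => /eqP <-.
  move=> i j e; apply: last_inj => /=.
  have [ei|ni] := eqVneq (last (a i) (p i)) x; first by rewrite (aux i j).
  have [ej|nj] := eqVneq (last (a j) (p j)) x; first by rewrite (aux j i).
  by move: e; rewrite /next (negbTE ni) (negbTE nj).
pose J i := xchoose (startE _ (nextQ i)).
have JE i : b (J i) = next i by apply/eqP/(xchooseP (startE _ (nextQ i))).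
have J_inj : injective J by move=> i j e; apply: next_inj; rewrite -!JE e.
pose r i := p i ++ (if last (a i) (p i) == x then b (J i) :: q (J i) else q (J i)).
have r_mem i z : z \in a i :: r i -> z \in a i :: p i \/ z \in b (J i) :: q (J i).
  rewrite -cat_cons mem_cat => /orP[|zq]; [by left | right].
  by move: zq; case: ifP => // _; rewrite inE => ->; rewrite orbT.
(* By [meet], [z] is in [S], hence is both the end of path [i] and the start of the continuation of
   path [j]. *)
have cross i j z : z \in a i :: p i -> z \in b (J j) :: q (J j) -> i = j.
  move=> zi zj; have zS := meet _ _ _ zi zj; apply: last_inj => /=.
  rewrite -(p_last _ _ zi) ?setU1r // -nextS -JE; last rewrite -?(q_head _ _ zj) ?setU1r //.
  by rewrite -(q_head _ _ zj) ?setU1r.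
apply: (@linked_of_walks _ _ _ _ a r).
  move=> i; have [aA _ path_p _] := walk_p i.
  have [_ lastB path_q _] := walk_q (J i).
  have sEE : E :\ (x, y) \subset E by apply: subD1set.
  have {}path_p := arc_sub_path sEE path_p; have {}path_q := arc_sub_path sEE path_q.
  have := JE i; rewrite /r /next last_cat cat_path path_p.
  case: eqP => [-> eb|_ eb]; last by rewrite -eb.
  by split; rewrite //= path_q andbT eb.
move=> i j z /r_mem[zi|zi] /r_mem[zj|zj].
- exact: disj_p zi zj.
- exact: cross zi zj.
- by rewrite (cross _ _ _ zj zi).
- exact/J_inj/(disj_q _ _ _ zi zj).
Qed.

(* Göring's argument: delete an arc [(x, y)].  If fewer than [n] vertices [S]
   then separate [A] from [B], apply induction to [A] and [x |: S], and to
   [y |: S] and [B]: separators of these pairs without the arc separate [A]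
   from [B] with it, and linkages can be glued along [S] and the arc. *)
Theorem menger E A B n :
  (exists2 S : {set T}, #|S| < n & separates E A B S) \/ linked E A B n.
Proof.
have [m] := ubnP #|E|; elim: m => // m IHm in E A B * => ltEm.
(* Without arcs every walk is a single vertex, so only [A :&: B] matters. *)
have [E0|[[x y] xyE]] := set_0Vmem E.
  have [ltn|le_n] := ltnP #|A :&: B| n.
    left; exists (A :&: B) => // a [|c p] /= aA aB; last by rewrite /arc E0 inE.
    by rewrite inE aA aB.
  right; exists (fun i => enum_val (widen_ord le_n i)), (fun=> [::]); split=> [i|i j z].
    by have := enum_valP (widen_ord le_n i); rewrite inE => /andP[].
  by rewrite !inE => /eqP-> /eqP/enum_val_inj/(congr1 val)/= /val_inj.
have ltE' : #|E :\ (x, y)| < m by rewrite (cardsD1 (x, y)) xyE in ltEm.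
have [[S ltS sepS]|[a [p [walk_p disj]]]] := IHm _ A B ltE'; last first.
  right; exists a, p; split=> // i; have [? ? pp ?] := walk_p i; split=> //.
  by apply: arc_sub_path pp; apply: subD1set.
have [[S' ltS' sepS']|linkP] := IHm _ A (x |: S) ltE'.
  by left; exists S' => //; apply: separates_left sepS sepS'.
have [[S' ltS' sepS']|linkQ] := IHm _ (y |: S) B ltE'.
  by left; exists S' => //; apply: separates_right sepS sepS'.
by right; apply: linked_cat linkP linkQ.
Qed.
End Menger.

(** * Rank bound for the edge functionals *)

Section Algebra.
Local Open Scope ring_scope.

(** The pairs index a basis of the symmetric bivariate polynomials of degree less than [k] in each
    variable. *)
Lemma card_le_pairs (k : nat) :
  #|[set p : 'I_k * 'I_k | (p.1 <= p.2)%N]| = 'C(k.+1, 2).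
Proof.
rewrite -sum1dep_card (eq_bigl (fun p : 'I_k * 'I_k => true && (p.1 <= p.2)%N)) //.
rewrite -(pair_big_dep xpredT (fun i j : 'I_k => (i <= j)%N) (fun _ _ => 1%N)) /=.
rewrite (exchange_big_dep xpredT) //= -bin2_sum big_mkord big_ord_recl /= add0n.
apply: eq_bigr => j _; rewrite sum1_card /bump /= add1n.
by rewrite -sum1_card -(big_ord_widen k (fun _ => 1%N) (ltn_ord j)) sum1_card card_ord.
Qed.

(** The functionals are the rows of [M], the test families the columns of [W]. Since [M *m W] is
    triangular with nonzero diagonal, [M] has rank [m], while the independent columns of [K] lie in
    its kernel. *)
Lemma edge_functionals_bound (F : fieldType) (T : finType) (t : T -> F) (k m : nat)
    (u v : 'I_m -> T) (q : 'I_m -> T -> {poly F}) :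
  injective t -> (k <= #|T|)%N ->
  (forall i w, (size (q i w) <= k)%N) ->
  (forall i j : 'I_m, (j < i)%N -> (q i (u j)).[t (v j)] = (q i (v j)).[t (u j)]) ->
  (forall i, (q i (u i)).[t (v i)] != (q i (v i)).[t (u i)]) ->
  (m + 'C(k.+1, 2) <= #|T| * k)%N.
Proof.
move=> t_inj le_kT size_q q_before q_at.
pose X := (T * 'I_k)%type; pose A := [set p : 'I_k * 'I_k | (p.1 <= p.2)%N].
pose N := #|{: X}|.
have sumX (G : X -> F) : \sum_(a < N) G (enum_val a) = \sum_w \sum_(l < k) G (w, l).
  by rewrite -big_enum_val /= pair_bigA; apply: eq_big => [[]|[]].
pose R i (a : X) := (a.1 == u i)%:R * t (v i) ^+ a.2 - (a.1 == v i)%:R * t (u i) ^+ a.2.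
have sumR i (G : X -> F) : \sum_(a < N) R i (enum_val a) * G (enum_val a) =
    \sum_(l < k) t (v i) ^+ l * G (u i, l) - \sum_(l < k) t (u i) ^+ l * G (v i, l).
  have pick1 x y : \sum_w \sum_(l < k) (w == x)%:R * t y ^+ l * G (w, l) =
      \sum_(l < k) t y ^+ l * G (x, l).
    rewrite (bigD1 x) //= [X in _ + X]big1 ?addr0 => [|w /negbTE wx].
      by apply: eq_bigr => l _; rewrite eqxx mul1r.
    by rewrite big1 // => l _; rewrite wx !mul0r.
  rewrite (sumX (fun a => R i a * G a)) -!pick1 -sumrB; apply: eq_bigr => w _.
  by rewrite -sumrB; apply: eq_bigr => l _; rewrite /R mulrBl.
pose M := \matrix_(i < m, a < N) R i (enum_val a).
pose W := \matrix_(a < N, j < m) (q j (enum_val a).1)`_(enum_val a).2.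
have MW i j : (M *m W) i j = (q j (u i)).[t (v i)] - (q j (v i)).[t (u i)].
  rewrite !mxE (eq_bigr (fun a => R i (enum_val a) * (q j (enum_val a).1)`_(enum_val a).2)).
    rewrite (sumR i (fun a => (q j a.1)`_a.2)) !(horner_coef_wide _ (size_q _ _)) /=.
    by congr (_ - _); apply: eq_bigr => l _; rewrite mulrC.
  by move=> a _; rewrite !mxE.
have rkM : \rank M = m.
  apply/eqP; rewrite eqn_leq rank_leq_row.
  suff: (M *m W) \in unitmx by move/mxrank_unit => {1}<-; apply: mxrankM_maxl.
  rewrite unitmxE det_trig ?unitfE.
    by apply/prodf_neq0 => i _; rewrite MW subr_eq0.
  by apply/is_trig_mxP => i j lt_ij; rewrite MW q_before ?subrr.
(* [s b] is the coefficient matrix of a symmetrised monomial. The disjunction keeps diagonal entries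
   equal to 1, in characteristic 2 as well. *)
pose S (b l r : 'I_k * 'I_k) := ((l == b) || (r == b))%:R : F.
pose s (b : 'I_k * 'I_k) (l l' : 'I_k) := S b (l, l') (l', l).
have s_sym b l l' : s b l l' = s b l' l by rewrite /s /S orbC.
pose K := \matrix_(a < N, b < #|A|)
  \sum_(l' < k) s (enum_val b) (enum_val a).2 l' * t (enum_val a).1 ^+ l'.
have MK : M *m K = 0.
  apply/matrixP => i b; rewrite [LHS]mxE [RHS]mxE.
  pose G (a : X) := \sum_(l' < k) s (enum_val b) a.2 l' * t a.1 ^+ l'.
  rewrite (eq_bigr (fun a => R i (enum_val a) * G (enum_val a))); last first.
    by move=> a _; rewrite !mxE.
  apply/eqP; rewrite sumR subr_eq0 /G; apply/eqP.
  under eq_bigr do rewrite mulr_sumr.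
  rewrite exchange_big /=; apply: eq_bigr => l _; rewrite mulr_sumr.
  by apply: eq_bigr => l' _; rewrite s_sym mulrCA [RHS]mulrCA [t _ ^+ _ * _]mulrC.
have rkK : \rank K = #|A|.
  rewrite -mxrank_tr; apply/eqP; apply: inj_row_free => c cK0.
  have coef0 (l l' : 'I_k) : \sum_b c 0 b * s (enum_val b) l l' = 0.
    (* For fixed [l], [p] collects the coefficients of row [l] of the combined symmetric matrix. It
       has size at most [k] and vanishes at the [#|T|] distinct numbers [t w], so it is zero. *)
    pose p := \poly_(j < k)
      if insub j is Some j' then \sum_b c 0 b * s (enum_val b) l j' else 0.
    have pE (j : 'I_k) : p`_j = \sum_b c 0 b * s (enum_val b) l j.
      by rewrite coef_poly ltn_ord valK.
    suff p0 : p = 0 by rewrite -pE p0 coef0.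
    have size_p : (size p <= k)%N by apply: size_poly.
    apply: contraTeq le_kT => nz_p; rewrite -ltnNge.
    have uniq_t : uniq [seq t w | w : T] by rewrite map_inj_uniq ?enum_uniq.
    have := max_poly_roots nz_p _ uniq_t; rewrite size_map -cardE => lt_size.
    apply: leq_trans (size_p); apply: lt_size; apply/allP => _ /mapP[w _ ->].
    apply/rootP; have := congr1 (fun B : 'rV__ => B 0 (enum_rank (w, l))) cK0.
    rewrite !mxE => <-; rewrite (horner_coef_wide _ size_p).
    under eq_bigr do rewrite pE mulr_suml.
    rewrite exchange_big /=; apply: eq_bigr => b _; rewrite !mxE enum_rankK mulr_sumr.
    by apply: eq_bigr => j _; rewrite mulrA.
  apply/rowP => b; rewrite mxE.
  have := enum_valP b; rewrite inE => le_b.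
  have := coef0 (enum_val b).1 (enum_val b).2.
  rewrite (bigD1 b) //= /s /S -surjective_pairing eqxx mulr1 big1 ?addr0 // => b' neq.
  have := enum_valP b'; rewrite inE => le_b'.
  case: eqP => [/enum_val_inj E|_]; first by rewrite E eqxx in neq.
  (* Two ordered pairs that are swaps of each other are diagonal, hence equal. *)
  case: eqP => [E|_]; last by rewrite mulr0.
  case/eqP: neq; apply: enum_val_inj.
  move: le_b le_b'; rewrite -E /=; case: (enum_val b) => i j /= h1 h2.
  by have -> : i = j by apply/val_inj/eqP; rewrite eqn_leq h1.
have := mulmx0_rank_max MK.
by rewrite rkM rkK card_le_pairs /N card_prod card_ord.
Qed.
End Algebra.

(** * From few disjoint paths to a test family for the new edge *)

(** Menger's theorem is applied to the neighbourhoods of [u] and [v]: a linkage of size [k] would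
    give [k] internally disjoint paths. [C] is the set reached from [u] outside the separator. *)
Lemma exists_separation (T : finType) (F : {set {set T}}) (u v : T) (k : nat) :
  0 < k -> u != v -> simple_edges F -> [set u; v] \notin F ->
  (forall ps, ivd_paths F u v ps -> size ps <= k.-1) ->
  exists S C : {set T},
    [/\ #|S| < k, u \notin S, v \notin S, u \in C /\ v \notin C &
        forall w z, [set w; z] \in F -> w \notin S -> z \notin S ->
          (w \in C) = (z \in C)].
Proof.
move=> k_gt0 neq_uv simpleF uvF few_paths.
have adjC x y : adj F x y = adj F y x by rewrite /adj setUC.
have adj_irr x : ~~ adj F x x.
  by apply/negP => /simpleF; rewrite setUid cards1.
(* Arcs at [u] and [v] are left out, so that linkage paths can serve as interiors of paths from [u]
   to [v]. *)
pose E := [set xy | [&& adj F xy.1 xy.2, xy.1 \notin [set u; v] & xy.2 \notin [set u; v]]].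
have [[S ltS sepS]|[a [p [walk_p disj]]]] :=
  menger E [set x | adj F u x] [set x | adj F v x] k; last first.
  have := few_paths [seq a i :: p i | i : 'I_k].
  rewrite size_map size_enum_ord; suff -> : ivd_paths F u v [seq a i :: p i | i : 'I_k].
    by move/(_ isT); rewrite leqNgt prednK ?leqnn.
  have inner i z : z \in a i :: p i -> z \notin [set u; v].
    have [uA _ path_p _] := walk_p i; rewrite !inE in uA *.
    case/predU1P => [->|].
      rewrite negb_or; apply/andP; split; first by apply: contraTneq uA => ->.
      by apply: contraNneq uvF => <-.
    elim: (p i) (a i) path_p => //= c q IHq b /andP[bc path_q].
    by case/predU1P => [->|/(IHq _ path_q)//]; move: bc; rewrite /arc !inE => /and3P[].
  apply/and3P; split.
  - rewrite map_inj_uniq ?enum_uniq // => i j [ea ep].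
    by apply: (disj i j (a i)); rewrite ?ea mem_head.
  - apply/allP => _ /mapP[i _ ->]; have [uA vB path_p uniq_p] := walk_p i.
    have nu : u \notin a i :: p i by apply/negP => /inner; rewrite set21.
    have nv : v \notin a i :: p i by apply/negP => /inner; rewrite set22.
    rewrite !inE in uA vB; rewrite /is_uv_path cons_uniq rcons_uniq mem_rcons in_cons.
    rewrite negb_or neq_uv nu nv uniq_p /= uA rcons_path adjC vB andbT.
    by apply: sub_path path_p => x y; rewrite /arc inE => /and3P[].
  - rewrite pairwise_map; have := enum_uniq 'I_k; rewrite uniq_pairwise.
    apply: sub_pairwise => i j neq_ij; apply/hasP => -[z zi zj].
    by case/eqP: neq_ij; apply: disj zi zj.
(* Dropping [u] and [v] is harmless: the interior of a simple path between them avoids both, so it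
   meets [S] only in [S']. *)
pose S' := S :\: [set u; v].
pose e x y := [&& adj F x y, x \notin S' & y \notin S'].
have eC : connect_sym e.
  by apply: sym_connect_sym => x y; rewrite /e adjC [(x \notin _) && _]andbC.
exists S', [set w | connect e u w].
rewrite !inE eqxx connect0; split=> //.
- by apply: leq_ltn_trans ltS; apply/subset_leq_card/subsetDl.
- by rewrite eqxx orbT.
- split=> //; apply/negP => /connectP[q0 path_q0 ev].
  case: (shortenP path_q0) ev => q path_q uniq_q _ {q0 path_q0}.
  case: (lastP q) path_q uniq_q => [_ _ /= ev|q' v']; first by rewrite ev eqxx in neq_uv.
  rewrite last_rcons => + + ev; rewrite -{v'}ev.
  case: q' => [|b q']; first by rewrite /= /e /adj (negbTE uvF).
  rewrite rcons_path => /andP[/andP[/and3P[ub _ bS] path_q'] /and3P[lastv _ _]].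
  rewrite cons_uniq mem_rcons in_cons negb_or rcons_uniq => /and3P[/andP[_ nu] nv _].
  have avoid : all (fun z => z \notin S') (b :: q').
    rewrite /= bS; elim: q' b path_q' {ub bS lastv nu nv} => //= c q' IHq b.
    by case/andP=> /and3P[_ _ ->] /IHq.
  have inner z : z \in b :: q' -> z \notin [set u; v].
    by move=> zq; rewrite !inE; apply/norP; split; apply: contraTneq zq => ->.
  have /hasP[z zq /= zS] : has [in S] (b :: q').
    apply: sepS; rewrite ?inE // 1?adjC //.
    apply: (sub_in_path (P := [in b :: q'])) path_q' => [x y xq yq|]; last exact/allP.
    by case/and3P=> xy _ _; rewrite /arc inE /= xy !inner.
  by have := allP avoid _ zq; rewrite inE zS andbT negbK (negbTE (inner _ zq)).
- move=> w z wz wS zS; rewrite !inE; apply: (same_connect_r eC).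
  by apply: connect1; rewrite /e /adj wz wS.
Qed.

Lemma separating_family (R : fieldType) (T : finType) (t : T -> R) (F : {set {set T}})
    (u v : T) (k : nat) :
  injective t ->
  0 < k -> u != v -> simple_edges F -> [set u; v] \notin F ->
  (forall ps, ivd_paths F u v ps -> size ps <= k.-1) ->
  exists q : T -> {poly R},
    [/\ forall w, size (q w) <= k,
        forall w z, [set w; z] \in F -> ((q w).[t z] = (q z).[t w])%R &
        ((q u).[t v] != (q v).[t u])%R].
Proof.
move=> t_inj k_gt0 neq_uv simpleF uvF few_paths.
have [S [C [ltS uS vS [uC vC] sameC]]] :=
  exists_separation k_gt0 neq_uv simpleF uvF few_paths.
pose a : {poly R} := (\prod_(x in S) ('X - (t x)%:P))%R.
have a_root w : (a.[t w] == 0)%R = (w \in S).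
  rewrite /a horner_prod; apply/prodf_eq0/idP => [[x xS]|wS].
    by rewrite hornerXsubC subr_eq0 => /eqP/t_inj->.
  by exists w; rewrite // hornerXsubC subrr.
exists (fun w => (if w \in C then a.[t w] *: a else 0)%R); split.
- move=> w; case: ifP => _; last by rewrite size_poly0.
  apply: leq_trans (size_scale_leq _ _) _.
  by rewrite /a -big_enum size_prod_XsubC -cardE.
- move=> w z wz.
  (* An edge touching [S] gives zero on both sides, every member being a multiple of [a]. Otherwise
     both ends lie on the same side, and [a.[t w] * a.[t z]] is symmetric. *)
  have [wS|wS] := boolP (w \in S).
    have aw0 : (a.[t w] = 0)%R by apply/eqP; rewrite a_root.
    by rewrite aw0 scale0r !(fun_if (horner^~ _)) !hornerE aw0 mulr0 !if_same.
  have [zS|zS] := boolP (z \in S).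
    have az0 : (a.[t z] = 0)%R by apply/eqP; rewrite a_root.
    by rewrite az0 scale0r !(fun_if (horner^~ _)) !hornerE az0 mulr0 !if_same.
  by rewrite (sameC w z) //; case: ifP => _; rewrite !hornerE // mulrC.
- by rewrite uC (negbTE vC) !hornerE mulf_neq0 ?a_root.
Qed.

Theorem theorem6 (T : finType) (E : {set {set T}}) (k : nat) :
  1 <= k -> simple_edges E -> k_constructible k E -> k.+1 <= #|T| ->
  #|E| <= #|T| * k - 'C(k.+1, 2).
Proof.
move=> k_gt0 simpleE [s [perm_s few_paths]] ltkT.
pose t (w : T) : rat := ((enum_rank w)%:R)%R.
have t_inj : injective t.
  by move=> w z /eqP; rewrite Num.Theory.eqr_nat => /eqP/val_inj/enum_rank_inj.
have uniq_s : uniq s by rewrite (perm_uniq perm_s) enum_uniq.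
have sE e : (e \in s) = (e \in E) by rewrite (perm_mem perm_s) mem_enum.
(* Each [x] bundles the two ends of the [i]-th edge with its test family. *)
have family (i : 'I_(size s)) : exists x : T * T * (T -> {poly rat}),
    [/\ nth set0 s i = [set x.1.1; x.1.2],
        forall w, size (x.2 w) <= k,
        forall w z, [set w; z] \in take i s -> ((x.2 w).[t z] = (x.2 z).[t w])%R &
        ((x.2 x.1.1).[t x.1.2] != (x.2 x.1.2).[t x.1.1])%R].
  have /cards2P[u [v [neq_uv def_e]]] : #|nth set0 s i| == 2.
    by apply/eqP/simpleE; rewrite -sE mem_nth.
  have [|||q [size_q q_before q_at]] :=
    @separating_family _ _ t [set e | e \in take i s] u v k t_inj k_gt0 neq_uv.
  - by move=> e; rewrite inE => /mem_take; rewrite sE => /simpleE.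
  - rewrite inE -def_e; apply/negP => /(nthP set0)[j].
    rewrite size_take_min leq_min => /andP[ltji ltjs]; rewrite nth_take // => /eqP.
    by rewrite nth_uniq // => /eqP eji; rewrite eji ltnn in ltji.
  - exact: few_paths (ltn_ord i) def_e neq_uv.
  by exists (u, v, q); split=> // w z wz; apply: q_before; rewrite inE.
have [x xP] := fin_all_exists family.
have bound := @edge_functionals_bound _ _ t k _ (fun i => (x i).1.1) (fun i => (x i).1.2)
  (fun i => (x i).2) t_inj (ltnW ltkT).
rewrite cardE -(perm_size perm_s).
(* [bound] is additive, so the truncated subtraction loses nothing. *)
apply: leq_trans (leq_sub2r _ (bound _ _ _)); first by rewrite addnK.
- by move=> i w; case: (xP i).
- move=> i j ltji; have [_ _ before _] := xP i; have [def_e _ _ _] := xP j.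
  apply: before; rewrite -def_e -(nth_take set0 ltji) mem_nth //.
  by rewrite size_take_min leq_min ltji ltn_ord.
- by move=> i; case: (xP i).
Qed.
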